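(* For every $s\in(-\infty,\infty)$ and every $n\ge2$, the measure $\mathcal V_s(P\Vert Q)$ is nonnegative on $\Gamma_n\times\Gamma_n$ and is convex in the pair of probability distributions $(P,Q)\in\Gamma_n\times\Gamma_n$.
   Context: $\Gamma_n=\{P=(p_1,\dots,p_n): p_i>0,\ \sum_{i=1}^n p_i=1\}$. For $P,Q\in\Gamma_n$ and $s\in\mathbb{R}$, $$\mathcal V_s(P\Vert Q)=\begin{cases}[s(s-1)]^{-1}\left[\sum_{i=1}^n\left(p_i^sq_i^{1-s}+p_i^{1-s}q_i^s\right)-2\right], & s\ne0,1,\\[4pt] J(P\Vert Q)=\sum_{i=1}^n (p_i-q_i)\ln\left(\frac{p_i}{q_i}\right), & s=0,1.\end{cases}$$ *)

(* Defs.v *)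
From mathcomp Require Import all_boot all_order all_algebra.
From mathcomp Require Import boolp classical_sets reals exp convex.

Set Implicit Arguments.
Unset Strict Implicit.
Unset Printing Implicit Defensive.

Import Order.TTheory GRing.Theory Num.Theory.

Local Open Scope classical_set_scope.
Local Open Scope ring_scope.

(* A distribution P = (p_1, ..., p_n) is a row vector, with p_i = P ord0 i. *)
Definition Gamma (R : realType) (n : nat) : set 'rV[R]_n :=
  [set P | (forall i : 'I_n, 0 < P ord0 i) /\ \sum_(i < n) P ord0 i = 1].

Definition Jdiv (R : realType) (n : nat) (P Q : 'rV[R]_n) : R :=
  \sum_(i < n) (P ord0 i - Q ord0 i) * ln (P ord0 i / Q ord0 i).

(* Only meaningful on Gamma: elsewhere powR and ln take their conventional
   values at nonpositive arguments. *)
Definition Vdiv (R : realType) (n : nat) (s : R) (P Q : 'rV[R]_n) : R :=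
  if (s == 0) || (s == 1) then Jdiv P Q
  else (s * (s - 1))^-1 *
       (\sum_(i < n) (powR (P ord0 i) s * powR (Q ord0 i) (1 - s) +
                      powR (P ord0 i) (1 - s) * powR (Q ord0 i) s) - 2).

(* Main.v *)
Require Import Defs.
From mathcomp Require Import all_boot all_order all_algebra.
From mathcomp Require Import boolp classical_sets reals exp convex.
From mathcomp Require Import interval_inference sequences ring lra.

Import Order.TTheory GRing.Theory Num.Theory.

Local Open Scope classical_set_scope.
Local Open Scope ring_scope.

(** Up to a term that is linear in (p, q), the summand of V_s splits as
    k(p, q) + k(q, p), where k is the relative divergence of type s below.  The
    linear terms are chosen so that k vanishes on the diagonal and is
    nonnegative everywhere ([rel_div_ge0], from convexity of the exponential);
    summed over the simplex they give exactly the -2 in V_s, and in the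
    logarithmic case they cancel ([Vdiv_rel_div]).  This gives nonnegativity term by term.

    For convexity, dividing the first argument of k by a ratio r > 0 changes k
    only by a nonnegative factor and a linear term ([rel_div_rescale]).  With
    r = p0 / q0 the point (p0, q0) moves to the diagonal, where k attains its
    minimum 0; so the linear term is a plane that touches k at (p0, q0) and
    lies below k ([rel_div_tangent]).  A function with a supporting plane at
    every point is convex, hence each summand is jointly convex in (p_i, q_i). *)

(** The Cressie-Read divergence of type s of two positive numbers; the
    logarithmic branch is its limit at s = 1.  It also serves s = 0, because the
    limit there is the same expression with p and q exchanged and only the
    symmetrised sum is used. *)
Definition rel_div (R : realType) (s p q : R) : R :=
  if (s == 0) || (s == 1) then p * ln (p / q) - p + q
  else (s * (s - 1))^-1 *
       (powR p s * powR q (1 - s) - (s * p + (1 - s) * q)).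

Arguments rel_div {R} s p q.

Lemma expR_chord (R : realType) (t x : R) :
  0 <= t <= 1 -> expR (t * x) <= t * expR x + (1 - t).
Proof.
case/andP=> t0 t1; have := convex_expR (Itv01 t0 t1) x 0.
by rewrite !convRE /= mulr0 addr0 expR0 mulr1.
Qed.

(** The left-hand side is the second divided difference of y |-> expR (y * x) at
    the nodes 0, 1 and s.  The three cases say which node lies between the other
    two, and each is the chord inequality at that node. *)
Lemma expR_divided_difference_ge0 (R : realType) (s x : R) :
  s != 0 -> s != 1 ->
  0 <= (s * (s - 1))^-1 * (expR (s * x) - (s * expR x + (1 - s))).
Proof.
move=> s0 s1; case: (ltrgtP s 0) s0 => // [sN|sP] _.
- rewrite mulr_ge0 ?invr_ge0 //; first by nra.
  (* 0 lies between s and 1, at the fraction 1 / (1 - s) from 1. *)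
  have d0 : 0 < 1 - s by lra.
  have t01 : 0 <= (1 - s)^-1 <= 1.
    by rewrite invr_ge0 ltW //= invf_le1 //; lra.
  have := expR_chord _ _ ((s - 1) * x) t01.
  have -> : (1 - s)^-1 * ((s - 1) * x) = - x by field; rewrite gt_eqF.
  have -> : (s - 1) * x = s * x + - x by ring.
  rewrite expRD expRN.
  have e0 := expR_gt0 x; have f0 := expR_gt0 (s * x).
  rewrite -(ler_pM2l (mulr_gt0 d0 e0)).
  have -> : (1 - s) * expR x * (expR x)^-1 = 1 - s by field; rewrite gt_eqF.
  have -> : (1 - s) * expR x *
    ((1 - s)^-1 * (expR (s * x) * (expR x)^-1) + (1 - (1 - s)^-1)) =
    expR (s * x) - s * expR x by field; rewrite !gt_eqF.
  lra.
- case: (ltrgtP s 1) s1 => // [sl|sg] _.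
  + rewrite mulr_le0 //; first by rewrite invr_le0; nra.
    have s01 : 0 <= s <= 1 by lra.
    by have := expR_chord _ _ x s01; lra.
  + rewrite mulr_ge0 ?invr_ge0 //; first by nra.
    have t01 : 0 <= s^-1 <= 1 by rewrite invr_ge0 ltW //= invf_le1 // ltW.
    have := expR_chord _ _ (s * x) t01.
    rewrite mulKf ?gt_eqF // -(ler_pM2l sP).
    have -> : s * (s^-1 * expR (s * x) + (1 - s^-1)) = expR (s * x) + s - 1.
      by field; rewrite gt_eqF.
    lra.
Qed.

Lemma rel_div_ge0 (R : realType) (s p q : R) :
  0 < p -> 0 < q -> 0 <= rel_div s p q.
Proof.
move=> p0 q0; set x := ln (p / q).
have pE : p = q * expR x.
  by rewrite /x lnK ?posrE ?divr_gt0 // mulrC divfK ?gt_eqF.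
rewrite /rel_div; case: ifPn => [_|].
- (* This is p * (expR (- x) - 1 + x). *)
  have qE : q = p * expR (- x) by rewrite pE -mulrA -expRD subrr expR0 mulr1.
  have e1 := expR_ge1Dx (- x).
  have -> : p * ln (p / q) - p + q = p * (expR (- x) - 1 + x).
    by rewrite -/x [in LHS]qE; ring.
  by apply: mulr_ge0; [exact: ltW | lra].
- rewrite negb_or => /andP[s0 s1].
  have -> : powR p s * powR q (1 - s) = q * expR (s * x).
    rewrite pE powRM ?expR_ge0 ?ltW // mulrAC -powRD ?(gt_eqF q0) ?implybT //.
    rewrite subrKC powRr1 ?ltW //.
    by rewrite /powR gt_eqF ?expR_gt0 // expRK.
  have -> : (s * (s - 1))^-1 * (q * expR (s * x) - (s * p + (1 - s) * q)) =
     q * ((s * (s - 1))^-1 * (expR (s * x) - (s * expR x + (1 - s)))).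
    by rewrite [in LHS]pE; ring.
  by rewrite mulr_ge0 ?expR_divided_difference_ge0 ?ltW.
Qed.

Lemma rel_div_diag (R : realType) (s p : R) : 0 < p -> rel_div s p p = 0.
Proof.
move=> p0; rewrite /rel_div divff ?(gt_eqF p0) // ln1 -powRD ?(gt_eqF p0) ?implybT //.
rewrite subrKC powRr1 ?ltW //.
by case: ifP => _; ring.
Qed.

(** The power p^s picks up the factor r^s, and ln (p / q) the summand ln r, which
    contributes p * ln r.  So what does not scale by the common factor c (r^s or
    r) is linear in (p, q). *)
Lemma rel_div_rescale (R : realType) (s r : R) : 0 < r ->
  exists c A B : R, 0 <= c /\ forall p q : R, 0 < p -> 0 < q ->
    rel_div s p q = c * rel_div s (p / r) q + (A * p + B * q).
Proof.
move=> r0; rewrite /rel_div; case: ((s == 0) || (s == 1)).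
- exists r, (ln r), (1 - r); split; first exact: ltW.
  move=> p q p0 q0.
  have -> : p / q = r * (p / r / q) by field; rewrite (gt_eqF q0) (gt_eqF r0).
  rewrite lnM ?posrE ?divr_gt0 //.
  by field; rewrite gt_eqF.
- set k := (s * (s - 1))^-1.
  exists (powR r s), (k * (powR r s * s / r - s)), (k * (1 - s) * (powR r s - 1)).
  split=> [|p q p0 q0]; first exact: powR_ge0.
  have -> : powR p s = powR r s * powR (p / r) s.
    by rewrite -powRM ?divr_ge0 ?ltW // mulrC divfK ?gt_eqF.
  by ring.
Qed.

Lemma rel_div_tangent (R : realType) (s p0 q0 : R) : 0 < p0 -> 0 < q0 ->
  exists A B : R, rel_div s p0 q0 = A * p0 + B * q0 /\
    forall p q : R, 0 < p -> 0 < q -> A * p + B * q <= rel_div s p q.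
Proof.
move=> p0_gt0 q0_gt0; have r0 : 0 < p0 / q0 by rewrite divr_gt0.
have [c [A [B [c0 E]]]] := rel_div_rescale _ s _ r0.
exists A, B; split=> [|p q p_gt0 q_gt0].
- have pE : p0 / (p0 / q0) = q0 by field; rewrite !gt_eqF.
  by rewrite E // pE rel_div_diag // mulr0 add0r.
- by rewrite E // lerDr mulr_ge0 // rel_div_ge0 // divr_gt0.
Qed.

Lemma rel_div_convex (R : realType) (s t p q p' q' : R) : 0 <= t <= 1 ->
  0 < p -> 0 < q -> 0 < p' -> 0 < q' ->
  rel_div s (t * p + (1 - t) * p') (t * q + (1 - t) * q') <=
  t * rel_div s p q + (1 - t) * rel_div s p' q'.
Proof.
move=> t01 p0 q0 p0' q0'.
have conv_gt0 x y : 0 < x -> 0 < y -> 0 < t * x + (1 - t) * y.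
  by move=> ? ?; nra.
have [A [B [-> le]]] := rel_div_tangent _ s _ _ (conv_gt0 _ _ p0 p0') (conv_gt0 _ _ q0 q0').
have := le _ _ p0 q0; have := le _ _ p0' q0'.
by nra.
Qed.

Lemma Vdiv_rel_div (R : realType) (s : R) (n : nat) (P Q : 'rV[R]_n) :
  Gamma P -> Gamma Q ->
  Vdiv s P Q = \sum_(i < n) (rel_div s (P ord0 i) (Q ord0 i) +
                             rel_div s (Q ord0 i) (P ord0 i)).
Proof.
move=> [Pgt0 P1] [Qgt0 Q1]; rewrite /Vdiv /Jdiv /rel_div; case: ifPn => _.
- apply: eq_bigr => i _.
  have -> : Q ord0 i / P ord0 i = (P ord0 i / Q ord0 i)^-1 by rewrite invf_div.
  by rewrite lnV ?posrE ?divr_gt0 //; ring.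
- have -> : 2 = \sum_(i < n) (P ord0 i + Q ord0 i) :> R.
    by rewrite big_split /= P1 Q1.
  rewrite -sumrB mulr_sumr; apply: eq_bigr => i _.
  by ring.
Qed.

Lemma Gamma_convex (R : realType) (n : nat) (t : R) (P Q : 'rV[R]_n) :
  0 <= t <= 1 -> Gamma P -> Gamma Q -> Gamma (t *: P + (1 - t) *: Q).
Proof.
move=> t01 [Pgt0 P1] [Qgt0 Q1]; split=> [i|].
- by rewrite !mxE; have := Pgt0 i; have := Qgt0 i; nra.
- under eq_bigr do rewrite !mxE.
  by rewrite big_split /= -!mulr_sumr P1 Q1; ring.
Qed.

Theorem mainTheorem3 (R : realType) (s : R) (n : nat) (hn : (2 <= n)%N) :
  (forall P Q : 'rV[R]_n, Gamma P -> Gamma Q -> 0 <= Vdiv s P Q) /\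
  convex_function (E := ('rV[R]_n * 'rV[R]_n)%type)
    (@Gamma R n `*` @Gamma R n) (fun PQ => Vdiv s PQ.1 PQ.2).
Proof.
split=> [P Q GP GQ|t [P Q] [P' Q'] /set_mem[/= GP GQ] /set_mem[/= GP' GQ']].
- rewrite Vdiv_rel_div //; apply: sumr_ge0 => i _.
  by case: GP GQ => [P0 _] [Q0 _]; rewrite addr_ge0 ?rel_div_ge0.
- have t01 : 0 <= t%:num <= 1 by rewrite ge0 le1.
  rewrite convRE.
  change (Vdiv s (t%:num *: P + (1 - t%:num) *: P')
                 (t%:num *: Q + (1 - t%:num) *: Q') <=
          t%:num * Vdiv s P Q + (1 - t%:num) * Vdiv s P' Q').
  rewrite !Vdiv_rel_div //; try exact: Gamma_convex.
  rewrite !mulr_sumr -big_split /=; apply: ler_sum => i _; rewrite !mxE.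
  case: GP GQ GP' GQ' => [P0 _] [Q0 _] [P0' _] [Q0' _].
  rewrite !mulrDr addrACA.
  by apply: lerD; apply: rel_div_convex.
Qed.
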